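(* Let $k\geq r\geq2$, and let $G$ be a $k$-partite $r$-graph of order $n$. If $p>1$, then \[ \lambda^{(p)}(G)\leq r!\binom{k}{r}^{1/p}k^{-r/p}e(G)^{1-1/p}. \] Also, if $p>1$, then \[ \lambda^{(p)}(G)<r!\binom{k}{r}k^{-r}n^{r-r/p}, \] unless $k\mid n$ and $G=T_k^r(n)$.
   Context: An $r$-graph of order $n$ is an $r$-uniform hypergraph with vertex set $[n]$; $e(G)$ is its number of edges. Its polynomial form is $P_G([x_i])=r!\sum_{\{i_1,\ldots,i_r\}\in E(G)}x_{i_1}\cdots x_{i_r}$, and for real $p\geq1$ its $p$-spectral radius is $\lambda^{(p)}(G)=\max_{|x_1|^p+\cdots+|x_n|^p=1}P_G([x_i])$. An $r$-graph is $k$-partite if its vertex set can be partitioned into $k$ sets so that each edge contains at most one vertex from each set; an edge-maximal $k$-partite $r$-graph is complete $k$-partite. $T_k^r(n)$ denotes the complete $k$-partite $r$-graph of order $n$ with parts of sizes $\lfloor n/k\rfloor$ or $\lceil n/k\rceil$. *)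

(* Defs.v *)
From mathcomp Require Import all_boot all_order all_algebra.
From mathcomp Require Import all_classical all_reals all_analysis.
Import Order.TTheory GRing.Theory Num.Theory.
Import numFieldNormedType.Exports.

Set Implicit Arguments.
Unset Strict Implicit.
Unset Printing Implicit Defensive.

Local Open Scope classical_set_scope.
Local Open Scope ring_scope.

Record uniform_hypergraph (r n : nat) := UniformHypergraph {
  edges :> {set {set 'I_n}};
  edge_card : forall e : {set 'I_n}, e \in edges -> #|e| = r
}.

Definition num_edges (r n : nat) (G : uniform_hypergraph r n) : nat := #|edges G|.

(* A partition of [n] into k (possibly empty) sets is given by the map
   f : 'I_n -> 'I_k sending a vertex to the index of its part. *)
Definition part_of (k n : nat) (f : 'I_n -> 'I_k) (c : 'I_k) : {set 'I_n} :=
  [set v | f v == c]%SET.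

Definition partite_edge (k n : nat) (f : 'I_n -> 'I_k) (e : {set 'I_n}) : bool :=
  [forall c : 'I_k, #|e :&: part_of f c| <= 1]%N.

Definition kpartite (k r n : nat) (G : uniform_hypergraph r n) : Prop :=
  exists f : 'I_n -> 'I_k,
    forall e : {set 'I_n}, e \in edges G -> partite_edge f e.

Definition complete_kpartite_with (k r n : nat) (f : 'I_n -> 'I_k)
    (G : uniform_hypergraph r n) : Prop :=
  edges G = [set e : {set 'I_n} | (#|e| == r) && partite_edge f e]%SET.

(* T_k^r(n) is only determined up to the choice of the balanced partition;
   [is_turan k G] says that G is such a graph. The ceiling of n/k is
   (n + k - 1) %/ k. *)
Definition is_turan (k r n : nat) (G : uniform_hypergraph r n) : Prop :=
  exists f : 'I_n -> 'I_k,
    (forall c : 'I_k, #|part_of f c| = (n %/ k)%N \/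
                      #|part_of f c| = ((n + k - 1) %/ k)%N) /\
    complete_kpartite_with f G.

Definition poly_form (R : realType) (r n : nat) (G : uniform_hypergraph r n)
    (x : 'rV[R]_n) : R :=
  r`!%:R * \sum_(e in edges G) \prod_(i in e) x ord0 i.

Definition lp_sphere (R : realType) (n : nat) (p : R) : set 'rV[R]_n :=
  [set x | \sum_(i < n) `|x ord0 i| `^ p = 1].
Arguments lp_sphere {R} n p.

(* A maximum for n > 0, see [spectral_radius_max]. *)
Definition spectral_radius (R : realType) (r n : nat) (p : R)
    (G : uniform_hypergraph r n) : R :=
  sup [set poly_form G x | x in lp_sphere n p].

Lemma powR_norm_continuous (R : realType) (p : R) :
  0 < p -> continuous (fun a : R => `|a| `^ p).
Proof.
move=> p0 a; have [->|a0] := eqVneq a 0.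
  have Lp : (fun x : R => x `^ p) @ 0^'+ --> (0 : R) by exact: powR_cvg0.
  have E0 : `|0 : R| `^ p = 0 by rewrite normr0 powR0// gt_eqF.
  apply/cvgrPdist_lt => e e0; rewrite /= E0.
  move/cvgrPdist_lt : Lp => /(_ e e0) [d /= d0 H].
  exists d => //= x /=; rewrite sub0r normrN => xd.
  have [->|x0] := eqVneq x 0.
    by rewrite E0 subrr normr0.
  by apply: H; rewrite /= ?sub0r ?normrN ?normr_id ?normr_gt0.
have na : `|a| \in `]0, +oo[ by rewrite in_itv/= andbT normr_gt0.
apply: (@continuous_comp _ _ _ (fun a : R => `|a|) (fun b : R => b `^ p)).
  exact: norm_continuous.
exact/differentiable_continuous/derivable1_diffP/derivable_powR.
Qed.

Lemma poly_form_continuous (R : realType) (r n : nat) (G : uniform_hypergraph r n) :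
  continuous (@poly_form R r n G).
Proof.
move=> x; apply: (@continuousM _ _ (fun=> r`!%:R)
  (fun x : 'rV[R]_n => \sum_(e in edges G) \prod_(i in e) x ord0 i)).
  exact: cst_continuous.
apply: (@continuous_big R _ +%R 0); first exact: add_continuous.
move=> e _; apply: (@continuous_big R _ *%R 1); first exact: mul_continuous.
by move=> i _; exact: coord_continuous.
Qed.

Lemma lp_sphere_compact (R : realType) (n : nat) (p : R) :
  0 < p -> compact (@lp_sphere R n p).
Proof.
move=> p0.
apply: (@subclosed_compact _ (lp_sphere n p)
  [set x : 'rV[R]_n | forall i, `[-1, 1]%classic (x ord0 i)]).
- have -> : @lp_sphere R n p =
    (fun x : 'rV[R]_n => \sum_(i < n) `|x ord0 i| `^ p) @^-1` [set 1] by [].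
  apply: preimage_closed; last exact: closed_eq.
  move=> x _; apply: (@continuous_big R _ +%R 0); first exact: add_continuous.
  move=> i _ y; apply: (@continuous_comp _ _ _ (fun x : 'rV[R]_n => x ord0 i)
    (fun a : R => `|a| `^ p)); first exact: coord_continuous.
  exact: powR_norm_continuous.
- exact: (@rV_compact R n (fun=> `[-1, 1]%classic) (fun=> @segment_compact R _ _)).
- move=> x /= x1 i; rewrite in_itv/= -ler_norml leNgt; apply/negP => xi.
  have : 1 < `|x ord0 i| `^ p.
    have <- : 1 `^ p = 1 :> R by rewrite powR1.
    by rewrite gt0_ltr_powR// nnegrE.
  apply/negP; rewrite -leNgt -[leRHS]x1 (bigD1 i)//= lerDl.
  by apply: sumr_ge0 => j _; exact: powR_ge0.
Qed.

Lemma spectral_radius_max (R : realType) (r n : nat) (p : R) (G : uniform_hypergraph r n) :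
  (0 < n)%N -> 0 < p ->
  exists x : 'rV[R]_n, [/\ lp_sphere n p x,
    poly_form G x = spectral_radius p G &
    forall y, lp_sphere n p y -> poly_form G y <= spectral_radius p G].
Proof.
case: n G => // n G _ p0.
have S0 : lp_sphere n.+1 p !=set0.
  exists (delta_mx ord0 ord0); rewrite /lp_sphere/= (bigD1 ord0)//= mxE !eqxx/=.
  rewrite normr1 powR1 big1 ?addr0// => i i0.
  by rewrite mxE (negbTE i0) andbF normr0 powR0// gt_eqF.
have [x xS xM] := compact_EVT_max S0 (@lp_sphere_compact R n.+1 p p0)
  (continuous_subspaceT (@poly_form_continuous R r n.+1 G)).
have E : poly_form G x = spectral_radius p G.
  apply/le_anti/andP; split.
    apply: ub_le_sup; last by exists x => //; exact/set_mem.
    by exists (poly_form G x) => _ [y /mem_set yS <-]; exact: xM.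
  apply: ge_sup; first by case: S0 => y yS; exists (poly_form G y), y.
  by move=> _ [y /mem_set yS <-]; exact: xM.
exists x; split=> //; first exact/set_mem.
by move=> y /mem_set yS; rewrite -E; exact: xM.
Qed.

(* Main.v *)
(* For [x] on the sphere and [y v = |x v|^p], the power mean inequality bounds
   the sum over the edges of [G] of the products of [x] by
   [e(G)^(1-1/p) * S^(1/p)], where [S] is the same sum for [y].  Since an edge
   meets each part at most once, [S] is at most the [r]-th elementary symmetric
   function of the [k] part sums of [y], which add up to 1, so Maclaurin's
   inequality gives [S <= C(k,r) / k^r].  The same argument with [y = 1] gives
   [e(G) <= C(k,r) (n/k)^r]; the equality case of Maclaurin's inequality leaves
   only the complete [k]-partite graph with equal parts, and any strict
   inequality here carries over to the spectral radius.

   Elementary symmetric functions of [s] are handled as the coefficients of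
   [\prod_i (1 + s i *: 'X)]. *)
Require Import Defs.
From mathcomp Require Import all_boot all_order all_algebra.
From mathcomp Require Import all_classical all_reals all_analysis.
From mathcomp Require Import ring lra.
Import Order.TTheory GRing.Theory Num.Theory.
Import numFieldNormedType.Exports.
Local Open Scope ring_scope.

(** * Coefficients of products of linear factors *)

Lemma coef_linear_factorM (R : comNzRingType) (a : R) (q : {poly R}) m :
  ((1 + a *: 'X) * q)`_m = q`_m + a * (if m == 0%N then 0 else q`_m.-1).
Proof. by rewrite mulrDl mul1r coefD -scalerAl coefZ coefXM. Qed.

Lemma coef_prod_ge0 (R : realDomainType) (I : finType) (P : pred I)
    (F : I -> {poly R}) m :
  (forall i j, 0 <= (F i)`_j) -> 0 <= (\prod_(i | P i) F i)`_m.
Proof.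
move=> F0; elim/big_rec: _ m => [m|i q _ IH m]; first by rewrite coef1 ler0n.
by rewrite coefM sumr_ge0 // => j _; rewrite mulr_ge0.
Qed.

Lemma coef_prod_linear_ge0 (R : realDomainType) (I : finType) (P : pred I)
    (s : I -> R) m :
  (forall i, 0 <= s i) -> 0 <= (\prod_(i | P i) (1 + s i *: 'X))`_m.
Proof.
move=> s0; apply: coef_prod_ge0 => i j.
by rewrite coefD coef1 coefZ coefX addr_ge0 ?mulr_ge0 ?ler0n.
Qed.

(** Induction on the factors: a coefficient of [(1 + a *: 'X) * q] is a sum of two nonnegative
    terms, so if it vanishes then so does the coefficient of [q] at the same index, hence also the
    next one. *)
Lemma coef_prod_linear_eq0S (R : realDomainType) (I : finType) (P : pred I)
    (s : I -> R) m :
  (forall i, 0 <= s i) ->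
  (\prod_(i | P i) (1 + s i *: 'X))`_m = 0 ->
  (\prod_(i | P i) (1 + s i *: 'X))`_m.+1 = 0.
Proof.
move=> s0.
suff: (forall j, 0 <= (\prod_(i | P i) (1 + s i *: 'X))`_j) /\
      (forall j, (\prod_(i | P i) (1 + s i *: 'X))`_j = 0 ->
                 (\prod_(i | P i) (1 + s i *: 'X))`_j.+1 = 0).
  by case=> _; exact.
elim/big_rec: _ => [|i q _ [q0 qS]].
  by split=> j; rewrite !coef1 // ler0n.
have c0 j : 0 <= s i * (if j == 0%N then 0 else q`_j.-1).
  by rewrite mulr_ge0 //; case: ifP.
split=> j; rewrite !coef_linear_factorM ?addr_ge0 //=.
move=> /eqP; rewrite paddr_eq0 // => /andP[/eqP qj _].
by rewrite qS // qj mulr0 addr0.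
Qed.

Lemma coef_two_linear_factorsM (R : comNzRingType) (a b : R) (q : {poly R}) m :
  ((1 + a *: 'X) * ((1 + b *: 'X) * q))`_m.+2 =
  q`_m.+2 + (a + b) * q`_m.+1 + a * b * q`_m.
Proof. rewrite !coef_linear_factorM /=; ring. Qed.

Lemma coef_linear_factorX (R : comNzRingType) (a : R) k r :
  ((1 + a *: 'X) ^+ k)`_r = 'C(k, r)%:R * a ^+ r.
Proof.
elim: k r => [|k IH] [|r].
- by rewrite expr0 coef1 bin0 expr0 mulr1.
- by rewrite expr0 coef1 bin0n mul0r.
- by rewrite exprS coef_linear_factorM IH !bin0 mulr0 addr0.
rewrite exprS coef_linear_factorM /= !IH binS natrD exprS; ring.
Qed.

(** * Maclaurin's inequality with its strict case *)

Lemma exists_lt_gt_mean (R : realDomainType) (I : finType) (s : I -> R) m :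
  \sum_i s i = #|I|%:R * m -> (exists i, s i != m) ->
  exists i j, s i < m /\ m < s j.
Proof.
move=> sm ne.
have s0 : \sum_i (s i - m) = 0.
  by rewrite sumrB sm sumr_const mulr_natl subrr.
case: ne => i0 ni0.
have : [exists i, s i < m].
  apply: contraT; rewrite negb_exists => /forallP ge.
  have ge0 i : true -> 0 <= s i - m by rewrite subr_ge0 leNgt ge.
  have /eqP := psumr_eq0P ge0 s0 (i:=i0) isT.
  by rewrite subr_eq0 (negbTE ni0).
have : [exists i, m < s i].
  apply: contraT; rewrite negb_exists => /forallP le.
  have le0 i : true -> 0 <= - (s i - m) by rewrite opprB subr_ge0 leNgt le.
  have sN0 : \sum_i - (s i - m) = 0 by rewrite sumrN s0 oppr0.
  have /eqP := psumr_eq0P le0 sN0 (i:=i0) isT.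
  by rewrite oppr_eq0 subr_eq0 (negbTE ni0).
by move=> /existsP[j mj] /existsP[i im]; exists i, j.
Qed.

(* Smoothing: a value below the mean [m] and a value above it are moved, with
   constant sum, until one of them equals [m]. *)
Lemma maclaurin_lt (R : realFieldType) (I : finType) (s : I -> R) m r :
  (forall i, 0 <= s i) -> \sum_i s i = #|I|%:R * m -> 0 < m ->
  (r.+2 <= #|I|)%N -> (exists i, s i != m) ->
  (\prod_i (1 + s i *: 'X))`_r.+2 < 'C(#|I|, r.+2)%:R * m ^+ r.+2.
Proof.
(* Induction on the number of values different from [m]. *)
have [N] := ubnP #|[set i | s i != m]%SET|; elim: N s => // N IH s sN s0 sm m0 rI ne.
have B0 : 0 < 'C(#|I|, r.+2)%:R * m ^+ r.+2 by rewrite mulr_gt0 ?exprn_gt0 // ltr0n bin_gt0.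
have [i [j [im mj]]] := exists_lt_gt_mean _ _ _ _ sm ne.
have ji : j != i by apply: contraTneq mj => ->; rewrite -leNgt ltW.
(* The value at [i] becomes [m] even when [s j] is nearer to [m]; the new value at [j] may then fall
   below [m], but [m < s j] keeps it nonnegative. *)
pose s' l := if l == i then m else if l == j then s i + s j - m else s l.
have s'i : s' i = m by rewrite /s' eqxx.
have s'j : s' j = s i + s j - m by rewrite /s' (negbTE ji) eqxx.
have s'l l : l != i -> l != j -> s' l = s l by rewrite /s' => /negbTE-> /negbTE->.
have s'0 l : 0 <= s' l.
  rewrite /s'; case: ifP => _; first exact: ltW.
  by case: ifP => // _; have := s0 i; lra.
have s'm : \sum_l s' l = #|I|%:R * m.
  rewrite -sm (bigD1 i) //= [RHS](bigD1 i) //= (bigD1 j) //= [in RHS](bigD1 j) //=.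
  rewrite s'i s'j (eq_bigr s); last by move=> l /andP[]; exact: s'l.
  ring.
have s'N : (#|[set l | s' l != m]%SET| < N)%N.
  rewrite -ltnS; apply: leq_trans sN; rewrite ltnS; apply: proper_card.
  apply/properP; split.
    apply/fintype.subsetP => l; rewrite !inE /s'; case: (eqVneq l i) => [->|li].
      by rewrite eqxx.
    by case: (eqVneq l j) => [->|//] _; rewrite gt_eqF.
  by exists i; rewrite !inE ?s'i ?eqxx // lt_eqF.
have le' : (\prod_i (1 + s' i *: 'X))`_r.+2 <= 'C(#|I|, r.+2)%:R * m ^+ r.+2.
  have [/existsP[l ne']|] := boolP [exists l, s' l != m].
    by apply/ltW/IH => //; exists l.
  rewrite negb_exists => /forallP al.
  rewrite (eq_bigr (fun=> 1 + m *: 'X)) ?prodr_const ?coef_linear_factorX //.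
  by move=> l _; have := al l; rewrite negbK => /eqP ->.
(* A smoothing step gains
   [(m - s i) * (s j - m) * q]_r[, with]q[the product of the untouched factors. If]q[_r] vanished,
   so would the coefficient for [s], and that case is trivial because the bound is positive. *)
have [s_eq0|s_neq0] := eqVneq (\prod_i (1 + s i *: 'X))`_r.+2 0; first by rewrite s_eq0.
apply: lt_le_trans le'; move: s_neq0.
rewrite [in ltRHS](bigD1 i) //= [in ltRHS](bigD1 j) //= (bigD1 i) //= (bigD1 j) //=.
rewrite s'i s'j [in ltRHS](eq_bigr (fun l => 1 + s l *: 'X)); last first.
  by move=> l /andP[li lj]; rewrite s'l.
set q := \prod_(_ | _) _ => nz.
have q0 : 0 <= q`_r by exact: coef_prod_linear_ge0.
have {nz} : q`_r != 0.
  apply: contra nz => /eqP qr.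
  have q1 : q`_r.+1 = 0 by exact: coef_prod_linear_eq0S.
  have q2 : q`_r.+2 = 0 by exact: coef_prod_linear_eq0S.
  by rewrite coef_two_linear_factorsM qr q1 q2 !mulr0 !addr0.
move=> qn; have {q0 qn} qr : 0 < q`_r by rewrite lt_neqAle eq_sym qn.
rewrite !coef_two_linear_factorsM -subr_gt0.
have -> : q`_r.+2 + (m + (s i + s j - m)) * q`_r.+1 + m * (s i + s j - m) * q`_r -
  (q`_r.+2 + (s i + s j) * q`_r.+1 + s i * s j * q`_r) =
  (m - s i) * (s j - m) * q`_r by ring.
by rewrite !mulr_gt0 ?subr_gt0.
Qed.

Lemma maclaurin_le (R : realFieldType) (I : finType) (s : I -> R) m r :
  (forall i, 0 <= s i) -> \sum_i s i = #|I|%:R * m -> 0 < m ->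
  (r.+2 <= #|I|)%N ->
  (\prod_i (1 + s i *: 'X))`_r.+2 <= 'C(#|I|, r.+2)%:R * m ^+ r.+2.
Proof.
move=> s0 sm m0 rI.
have [/existsP ne|] := boolP [exists l, s l != m]; first exact/ltW/maclaurin_lt.
rewrite negb_exists => /forallP al.
rewrite (eq_bigr (fun=> 1 + m *: 'X)) ?prodr_const ?coef_linear_factorX //.
by move=> l _; have := al l; rewrite negbK => /eqP ->.
Qed.

(** * Transversals and elementary symmetric functions *)

(* Expanding the product over the parts, a transversal [e] contributes the term
   in which part [c] selects its unique element of [e], if there is one. *)
Lemma sum_partite_edges_le (R : realDomainType) (k r n : nat) (f : 'I_n -> 'I_k)
    (y : 'I_n -> R) :
  (forall v, 0 <= y v) ->
  \sum_(e : {set 'I_n} | (#|e| == r) && partite_edge f e) \prod_(v in e) y v <=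
  (\prod_c (1 + (\sum_(v | f v == c) y v) *: 'X))`_r.
Proof.
move=> y0.
(* [None] selects the summand 1 of a factor, and [Some v] the summand [y v *: 'X]. *)
pose ok (c : 'I_k) (o : option 'I_n) := if o is Some v then f v == c else true.
pose t (o : option 'I_n) : {poly R} := if o is Some v then y v *: 'X else 1.
have t0 o j : 0 <= (t o)`_j.
  by case: o => [v|]; rewrite /t ?coefZ ?coefX ?coef1 ?mulr_ge0 ?ler0n.
have -> : \prod_c (1 + (\sum_(v | f v == c) y v) *: 'X) =
    \sum_(g in family ok) \prod_c t (g c).
  rewrite -(bigA_distr_big_dep ok (fun=> t)); apply: eq_bigr => c _.
  rewrite (bigD1 None) //=; congr (_ + _); rewrite scaler_suml.
  rewrite [RHS](reindex_omap (@Some 'I_n) id) /=; last by case.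
  by apply: eq_bigl => v; rewrite /= eqxx !andbT.
pose g (e : {set 'I_n}) := [ffun c => [pick v in e | f v == c]].
pose D := [set e : {set 'I_n} | (#|e| == r) && partite_edge f e]%SET.
have injf e v w : e \in D -> v \in e -> w \in e -> f v = f w -> v = w.
  rewrite inE => /andP[_ /forallP /(_ (f w)) /card_le1_eqP H] ve we E.
  by apply: H; rewrite !inE ?ve ?we ?E eqxx.
have gE e v : e \in D -> v \in e -> g e (f v) = Some v.
  move=> eD ve; rewrite ffunE; case: pickP => [w /andP[we /eqP E]|/(_ v)].
    by rewrite (injf e w v).
  by rewrite ve eqxx.
have gS e v : g e (f v) = Some v -> v \in e.
  by rewrite ffunE; case: pickP => // w /andP[we _] [<-].
(* A transversal is recovered from its choice function: [v] lies in [e] exactly when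
   [g e (f v) = Some v]. *)
have ginj : {in D &, injective g}.
  move=> e e' eD e'D E; apply/finset.setP => v; apply/idP/idP => ve; apply: gS.
    by rewrite -E gE.
  by rewrite E gE.
rewrite coef_sum.
have -> : \sum_(e : {set 'I_n} | (#|e| == r) && partite_edge f e) \prod_(v in e) y v =
    \sum_(h in [set g e | e in D]%SET) (\prod_c t (h c))`_r.
  rewrite big_imset //=; apply: eq_big => [e|e eD]; first by rewrite inE.
  have {}eD : e \in D by rewrite inE.
  have -> : \prod_c t (g e c) = \prod_(v in e) (y v *: 'X).
    rewrite (partition_big f xpredT) //=; apply: eq_bigr => c _.
    rewrite ffunE; case: pickP => [v /andP[ve /eqP <-]|no].
      rewrite (big_pred1 v) // => w /=.
      apply/andP/eqP => [[we /eqP E]|->]; last by rewrite ve eqxx.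
      exact: (injf e).
    by rewrite big_pred0.
  rewrite scaler_prod prodr_const coefZ coefXn.
  by move: eD; rewrite inE => /andP[/eqP -> _]; rewrite eqxx mulr1.
(* Choice functions outside the image of [g] only add nonnegative terms. *)
rewrite [leRHS](bigID (mem [set g e | e in D]%SET)) /=.
rewrite (eq_bigl (fun h => (h \in family ok) && (h \in [set g e | e in D]%SET))); last first.
  move=> h /=; apply/idP/andP => [hD|[]//]; split=> //.
  case/imsetP: hD => e _ ->; apply/familyP => c; rewrite ffunE.
  by case: pickP => [v /andP[_]|].
by rewrite lerDl sumr_ge0 // => h _; exact: coef_prod_ge0.
Qed.

(** * The power mean inequality *)

Lemma prod_powR (R : realType) (I : finType) (P : pred I) (F : I -> R) (p : R) :
  (forall i, 0 <= F i) ->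
  \prod_(i | P i) (F i `^ p) = (\prod_(i | P i) F i) `^ p.
Proof.
move=> F0; suff [] : \prod_(i | P i) (F i `^ p) = (\prod_(i | P i) F i) `^ p /\
  0 <= \prod_(i | P i) F i by [].
elim/big_rec2: _ => [|i a b _ [-> b0]]; first by rewrite powR1.
by rewrite powRM // mulr_ge0.
Qed.

(* Young's inequality for [a i / S `^ p^-1] and [#|A|%:R `^ (p^-1 - 1)], where
   [S] is the sum of the [a i `^ p]. *)
Lemma sum_le_power_mean (R : realType) (I : finType) (A : {set I}) (a : I -> R)
    (p : R) :
  1 < p -> (forall i, 0 <= a i) ->
  \sum_(i in A) a i <=
  #|A|%:R `^ (1 - p^-1) * (\sum_(i in A) a i `^ p) `^ p^-1.
Proof.
move=> p1 a0; set S := \sum_(i in A) a i `^ p.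
have p0 : 0 < p by lra.
have p_neq0 : p != 0 by rewrite gt_eqF.
have ap0 i : i \in A -> 0 <= a i `^ p by rewrite powR_ge0.
have S0 : 0 <= S by exact: sumr_ge0.
have [SE|S_neq0] := eqVneq S 0.
  rewrite big1 ?mulr_ge0 ?powR_ge0 // => i iA.
  by apply/eqP; have /eqP := psumr_eq0P ap0 SE iA; rewrite powR_eq0 => /andP[].
have {S_neq0}S0 : 0 < S by rewrite lt_neqAle eq_sym S_neq0.
have N0 : 0 < #|A|%:R :> R.
  rewrite ltr0n lt0n cards_eq0; apply: contraTneq S0 => A0.
  by rewrite /S A0 big_set0 ltxx.
(* The exponent conjugate to [p], so that [w]^ q[is the cardinality of]A[, just as]u [^ p] is
   [S]. *)
pose q := (1 - p^-1)^-1.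
have pV1 : 0 < 1 - p^-1 by rewrite subr_gt0 invf_lt1.
have q0 : 0 < q by rewrite invr_gt0.
set w := #|A|%:R `^ _; set u := S `^ _.
have w0 : 0 < w by exact: powR_gt0.
have u0 : 0 < u by exact: powR_gt0.
have young i : i \in A ->
    a i / u * w^-1 <= a i `^ p / S / p + #|A|%:R^-1 / q.
  move=> iA; have -> : a i `^ p / S = (a i / u) `^ p.
    rewrite powRM ?invr_ge0 ?(ltW u0) //; congr (_ * _).
    by rewrite -powRN -powRrM mulNr mulVf // powR_inv1 // ltW.
  have -> : #|A|%:R^-1 = w^-1 `^ q :> R.
    by rewrite -powRN -powRrM mulNr mulfV ?gt_eqF // powR_inv1 // ltW.
  apply: conjugate_powR => //; rewrite ?mulr_ge0 ?invr_ge0 ?(ltW u0) ?(ltW w0) //.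
  by rewrite /q invrK addrC subrK.
(* Summed over [A], the right sides of [young] give [p^-1 + q^-1 = 1]. *)
suff : \sum_(i in A) (a i / u * w^-1) <= 1.
  rewrite -!mulr_suml ler_pdivrMr // mul1r ler_pdivrMr //.
apply: le_trans (ler_sum _ young) _.
rewrite big_split /= -!mulr_suml sumr_const -/S divff ?gt_eqF //.
by rewrite -[_^-1 *+ _]mulr_natl divff ?gt_eqF // !mul1r /q invrK addrC subrK.
Qed.

(** * Bounds for [k]-partite graphs *)

Lemma edges_sub_partite (k r n : nat) (f : 'I_n -> 'I_k)
    (G : uniform_hypergraph r n) :
  (forall e, e \in edges G -> partite_edge f e) ->
  edges G \subset [set e : {set 'I_n} | (#|e| == r) && partite_edge f e]%SET.
Proof.
move=> fG; apply/fintype.subsetP => e eG.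
by rewrite inE (edge_card eG) eqxx fG.
Qed.

Lemma sum_edges_le (R : realFieldType) (k r n : nat) (f : 'I_n -> 'I_k)
    (G : uniform_hypergraph r n) (y : 'I_n -> R) m :
  (2 <= r)%N -> (r <= k)%N ->
  (forall e, e \in edges G -> partite_edge f e) ->
  (forall v, 0 <= y v) -> \sum_v y v = k%:R * m -> 0 < m ->
  \sum_(e in edges G) \prod_(v in e) y v <= 'C(k, r)%:R * m ^+ r.
Proof.
move=> r2 rk fG y0 ym m0.
apply: (@le_trans _ _ (\prod_c (1 + (\sum_(v | f v == c) y v) *: 'X))`_r).
  apply: le_trans (sum_partite_edges_le _ _ _ _ f y y0).
  rewrite big_mkcond [leRHS]big_mkcond; apply: ler_sum => e _.
  have /fintype.subsetP/(_ e) := edges_sub_partite _ _ _ _ _ fG.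
  rewrite inE; case: ifP => [_ -> //|_ _].
  by case: ifP => // _; exact: prodr_ge0.
case: r G r2 rk fG => [|[|r]] // G _ rk fG; rewrite -[X in 'C(X, _)]card_ord.
apply: maclaurin_le => //; rewrite ?card_ord //.
  by move=> c; exact: sumr_ge0.
by rewrite -ym [RHS](partition_big f xpredT).
Qed.

(** Strictness has two sources: Maclaurin's inequality when some part size differs from [n / k], and
    otherwise a transversal missing from [G], since without one [G] would be the Turán graph and [k]
    would divide [n]. *)
Lemma num_edges_lt (R : realFieldType) (k r n : nat) (G : uniform_hypergraph r n) :
  (2 <= r)%N -> (r <= k)%N -> (0 < n)%N -> kpartite k G ->
  ~ ((k %| n)%N /\ is_turan k G) ->
  (num_edges G)%:R < 'C(k, r)%:R * (n%:R / k%:R) ^+ r :> R.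
Proof.
move=> r2 rk n0 [f fG] nT.
have k0 : (0 < k)%N by rewrite (leq_trans _ rk) // ltnW.
have kR : k%:R != 0 :> R by rewrite pnatr_eq0 -lt0n.
set m : R := n%:R / k%:R.
have m0 : 0 < m by rewrite divr_gt0 ?ltr0n.
pose T := [set e : {set 'I_n} | (#|e| == r) && partite_edge f e]%SET.
have GT : edges G \subset T := edges_sub_partite _ _ _ _ _ fG.
pose s c : R := #|part_of f c|%:R.
have TP : #|T|%:R <= (\prod_c (1 + s c *: 'X))`_r.
  have -> : #|T|%:R = \sum_(e : {set 'I_n} | (#|e| == r) && partite_edge f e)
      \prod_(v in e) 1 :> R.
    rewrite -sum1_card natr_sum; apply: eq_big => [e|e _]; first by rewrite inE.
    by rewrite big1.
  rewrite (eq_bigr (fun c => 1 + (\sum_(v | f v == c) 1) *: 'X)).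
    exact: sum_partite_edges_le.
  move=> c _; rewrite /s -sum1_card natr_sum; congr (1 + _ *: _).
  by apply: eq_bigl => v; rewrite inE.
have s0 c : 0 <= s c by rewrite ler0n.
have sn : \sum_c s c = k%:R * m.
  rewrite mulrC divfK // -natr_sum; congr (_%:R).
  rewrite -[RHS]card_ord -sum1_card (partition_big f xpredT) //=.
  by apply: eq_bigr => c _; rewrite sum1_card; apply: eq_card => v; rewrite inE.
have [/existsP ne|] := boolP [exists c, s c != m].
  apply: le_lt_trans (le_trans _ TP) _; first by rewrite ler_nat subset_leq_card.
  case: r r2 rk {G fG nT T GT TP} => [|[|r]] // _ rk.
  by rewrite -[X in 'C(X, _)]card_ord; apply: maclaurin_lt; rewrite ?card_ord.
rewrite negb_exists => /forallP al.
have sm c : s c = m by apply/eqP; have := al c; rewrite negbK.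
have nE c : n = (k * #|part_of f c|)%N.
  apply/eqP; rewrite -(eqr_nat R) natrM; have := sm c; rewrite /s => ->.
  by rewrite mulrC divfK.
have kn : (k %| n)%N by rewrite (nE (Ordinal k0)) dvdn_mulr.
have TB : #|T|%:R <= 'C(k, r)%:R * m ^+ r :> R.
  apply: le_trans TP _; rewrite (eq_bigr (fun=> 1 + m *: 'X)).
    by rewrite prodr_const card_ord coef_linear_factorX.
  by move=> c _; rewrite sm.
apply: lt_le_trans TB; rewrite ltr_nat.
apply: proper_card; rewrite finset.properEneq GT andbT; apply/eqP => E.
apply: nT; split=> //; exists f; split=> // c; left.
by rewrite [X in (X %/ _)%N](nE c) mulKn.
Qed.

Lemma poly_form_le (R : realType) (k r n : nat) (G : uniform_hypergraph r n)
    (p : R) (x : 'rV[R]_n) :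
  (2 <= r)%N -> (r <= k)%N -> kpartite k G -> 1 < p -> lp_sphere n p x ->
  poly_form G x <= r`!%:R * ('C(k, r)%:R / k%:R ^+ r) `^ p^-1
                   * (num_edges G)%:R `^ (1 - p^-1).
Proof.
move=> r2 rk [f fG] p1 x1.
have k0 : (0 < k)%N by rewrite (leq_trans _ rk) // ltnW.
have kR : k%:R != 0 :> R by rewrite pnatr_eq0 -lt0n.
rewrite /poly_form -mulrA ler_wpM2l // [leRHS]mulrC.
(* Points of the sphere may have negative coordinates, while the power mean needs nonnegative
   terms. *)
apply: (@le_trans _ _ (\sum_(e in edges G) \prod_(i in e) `|x ord0 i|)).
  by apply: ler_sum => e _; rewrite -normr_prod ler_norm.
apply: le_trans (sum_le_power_mean _ _ _ _ _ p1 _) _.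
  by move=> e; exact: prodr_ge0.
rewrite ler_wpM2l ?powR_ge0 // ge0_ler_powR ?invr_ge0 ?nnegrE //.
- by lra.
- by apply: sumr_ge0 => e _; exact: powR_ge0.
- under eq_bigr => e _ do rewrite -prod_powR //.
  rewrite -exprVn; apply: (sum_edges_le _ _ _ _ f) => //.
  + by rewrite divff.
  + by rewrite invr_gt0 ltr0n.
Qed.

(** * Bounds for the spectral radius *)

Lemma spectral_radius_le (R : realType) (k r n : nat) (G : uniform_hypergraph r n)
    (p : R) :
  (2 <= r)%N -> (r <= k)%N -> kpartite k G -> 1 < p ->
  spectral_radius p G <= r`!%:R * ('C(k, r)%:R / k%:R ^+ r) `^ p^-1
                         * (num_edges G)%:R `^ (1 - p^-1).
Proof.
move=> r2 rk hG p1; have [n0|] := posnP n; last first.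
  move=> n0; have [x [x1 <- _]] := spectral_radius_max G n0 (lt_trans ltr01 p1).
  exact: poly_form_le.
rewrite /spectral_radius.
(* For [n = 0] the sphere is empty, and the supremum of the empty set is 0 by convention. *)
have -> : lp_sphere n p = set0.
  rewrite -subset0 => x; rewrite /lp_sphere /= big1.
    by move/eqP; rewrite eq_sym oner_eq0.
  by move=> i _; have := ltn_ord i; rewrite [X in (_ < X)%N]n0.
by rewrite image_set0 sup0 !mulr_ge0 ?powR_ge0.
Qed.

Theorem theorem3 (R : realType) (k r n : nat) (G : uniform_hypergraph r n) (p : R)
    (hr : (2 <= r)%N) (hk : (r <= k)%N) (hG : kpartite k G) (hp : 1 < p) :
  spectral_radius p G
    <= r`!%:R * ('C(k, r)%:R `^ (p^-1)) * (k%:R `^ (- (r%:R / p)))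
       * ((num_edges G)%:R `^ (1 - p^-1))
  /\
  (~ ((k %| n)%N /\ is_turan k G) ->
   spectral_radius p G
     < r`!%:R * 'C(k, r)%:R * k%:R ^- r * (n%:R `^ (r%:R - r%:R / p))).
Proof.
have k0 : (0 < k)%N by rewrite (leq_trans _ hk) // ltnW.
have kR : 0 < k%:R :> R by rewrite ltr0n.
have C0 : 0 < 'C(k, r)%:R :> R by rewrite ltr0n bin_gt0.
have le := spectral_radius_le _ _ _ _ _ _ hr hk hG hp.
have pV1 : 0 < 1 - p^-1 by rewrite subr_gt0 invf_lt1 // (lt_trans ltr01).
split.
  apply: le_trans le _; rewrite powRM ?invr_ge0 ?exprn_ge0 // !mulrA.
  by rewrite -powR_invn // -powRrM mulNr.
(* The case [n = 0] falls under the exception: [k] divides 0, and the graph without vertices is a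
   Turán graph, as it has no set of [r] vertices. *)
move=> nT; have n0 : (0 < n)%N.
  rewrite lt0n; apply/eqP => n0; apply: nT; split; first by rewrite n0.
  exists (fun v => Ordinal k0); split=> [c|].
    left; rewrite [X in (X %/ _)%N]n0 div0n; apply: eq_card0 => v.
    by have := ltn_ord v; rewrite [X in (_ < X)%N]n0.
  have small (e : {set 'I_n}) : #|e| != r.
    by rewrite neq_ltn (leq_ltn_trans (max_card _)) // card_ord n0 (leq_trans _ hr).
  apply/finset.setP => e; rewrite inE (negbTE (small e)) /=.
  by apply: contraNF (small e) => /edge_card ->.
apply: le_lt_trans le _.
have Q0 : 0 < 'C(k, r)%:R / k%:R ^+ r :> R by rewrite divr_gt0 ?exprn_gt0.
have nR : 0 < n%:R :> R by rewrite ltr0n.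
(* The target is the first bound with the number of edges replaced by its maximum [C(k,r) (n/k)^r].
   As [1 - p^-1] is positive, the strict bound on the number of edges carries over. *)
have -> : r`!%:R * 'C(k, r)%:R * k%:R ^- r * n%:R `^ (r%:R - r%:R / p) =
  r`!%:R * ('C(k, r)%:R / k%:R ^+ r) `^ p^-1
  * ('C(k, r)%:R * (n%:R / k%:R) ^+ r) `^ (1 - p^-1).
  rewrite expr_div_n mulrCA [n%:R ^+ r * _]mulrC [_ `^ (1 - _)]powRM ?(ltW Q0) ?exprn_ge0 //.
  rewrite -[n%:R ^+ r]powR_mulrn // -powRrM mulrBr mulr1 !mulrA.
  congr (_ * _); rewrite -!mulrA; congr (_ * _).
  rewrite -powRD; last by rewrite addrC subrK oner_eq0.
  by rewrite addrC subrK powRr1 // ltW.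
rewrite ltr_pM2l ?mulr_gt0 ?powR_gt0 ?ltr0n ?fact_gt0 //.
rewrite gt0_ltr_powR ?nnegrE //; last exact: num_edges_lt.
Qed.
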